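(* Let $f(t)\in\mathbb{Q}[t]$ be a polynomial of degree $d$ that is irreducible over $\mathbb{Q}$. Suppose that either $d=p^m$ for some prime number $p\neq 3$ and some integer $m\geq 1$, or $d=2p^m$ for some prime number $p\geq 5$ and some integer $m\geq 1$. Then for any three roots $\alpha_1,\alpha_2,\alpha_3$ of $f(t)$ one has $\alpha_1+\alpha_2+\alpha_3\neq 0$ and $\alpha_1+\alpha_2-\alpha_3\neq 0$.
   Context: Roots are taken in $\mathbb{C}$ (equivalently, in an algebraic closure of $\mathbb{Q}$). *)

(* Defs.v *)
(* Roots are taken in algC, the algebraic closure of Q given by the algebraic
   complex numbers. *)
From mathcomp Require Export all_boot all_order all_algebra all_field.

Set Implicit Arguments.
Unset Strict Implicit.
Unset Printing Implicit Defensive.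

(* Main.v *)
(* Let the Galois group G act on the d roots of f, and let e = 1 or e = -1. The
   G-translates of a relation a1 + a2 + e a3 = 0 form an integral linear system
   satisfied by the vector of roots. If this system has only the zero solution
   mod p, it has only the zero solution in algC, which is absurd. A nonzero
   space of solutions mod p would contain a nonzero solution v fixed by a Sylow
   p-subgroup P of G, since P is a p-group acting in characteristic p.

   If d = p^m, then P is transitive, so v is a constant c and (2 + e) c = 0
   mod p, whence e = 1 and p = 3.

   If d = 2 p^m, then P has two orbits of size p^m; let x be 1 on the first and
   -1 on the second, so that 2 v = b + c x with constants b and c. The number
   k(s) = x(s a1) + x(s a2) + e x(s a3) is odd and sums to 0 over s in G, so it
   takes two distinct values. The relations (2 + e) b + k(s) c = 0 then give
   c = 0 and b = 0 mod p, because k(s) - k(t) and 2 + e have no prime factor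
   other than 2 and 3. *)
Require Import Defs.
From HB Require Import structures.
From mathcomp Require Import all_boot all_order all_algebra all_field.
From mathcomp Require Import all_fingroup all_solvable all_character.
From mathcomp Require Import ring zify.

Set Implicit Arguments.
Unset Strict Implicit.
Unset Printing Implicit Defensive.

Import Order.TTheory GRing.Theory Num.Theory.
Local Open Scope ring_scope.

(** * Translates of an integral relation and reduction mod p *)

(** The inverse puts the coefficient [r i] in row [s i], so each column is the relation [r]
    translated by one [s] in [G]. *)
Definition translates_mx n (G : {set 'S_n}) (r : 'I_n -> int) :
    'M[int]_(n, #|G|) :=
  \matrix_(j, k) r (((enum_val k)^-1%g : 'S_n) j).

Lemma translates_mxP (R : comNzRingType) n (G : {set 'S_n}) (r : 'I_n -> int)
    (v : 'rV[R]_n) :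
  v *m map_mx intr (translates_mx G r) = 0 <->
  {in G, forall s : 'S_n, \sum_i (r i)%:~R * v 0 (s i) = 0}.
Proof.
have E k : (v *m map_mx intr (translates_mx G r)) 0 k =
    \sum_i (r i)%:~R * v 0 ((enum_val k) i).
  rewrite mxE (reindex_inj (@perm_inj _ (enum_val k))) /=.
  by apply: eq_bigr => i _; rewrite !mxE permK mulrC.
split=> [v0 s Gs | v0].
  by rewrite -(enum_rankK_in Gs Gs) -E v0 mxE.
by apply/rowP=> k; rewrite E mxE v0 ?enum_valP.
Qed.

Lemma perm_mx_repr n (G : {group 'S_n}) (F : fieldType) :
  mx_repr G (fun s : 'S_n => perm_mx s : 'M[F]_n).
Proof. by split=> [|s t _ _]; rewrite ?perm_mx1 ?perm_mxM. Qed.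

(* A nonzero module over a p-group in characteristic p has nonzero fixed
   vectors, so the kernel mod p of the matrix of translates is trivial; a
   maximal minor that is nonzero mod p is then a nonzero integer. *)
Lemma relation_translates_eq0 (F : numFieldType) n p (G P : {group 'S_n})
    (r : 'I_n -> int) (a : 'I_n -> F) :
    prime p -> P \subset G -> (p.-group P)%g ->
    (forall v : 'I_n -> 'F_p,
       {in P, forall (s : 'S_n) i, v (s i) = v i} ->
       {in G, forall s : 'S_n, \sum_i (r i)%:~R * v (s i) = 0} ->
     forall i, v i = 0) ->
    {in G, forall s : 'S_n, \sum_i (r i)%:~R * a (s i) = 0} ->
  forall i, a i = 0.
Proof.
move=> p_pr sPG pP fixed0 relG.
set N := translates_mx G r.
have freeNp : row_free (map_mx intr N : 'M['F_p]_(n, #|G|)).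
  rewrite -kermx_eq0; apply/negPn/negP=> nzU.
  set U := kermx _ in nzU.
  pose rP := MxRepresentation (perm_mx_repr P 'F_p).
  have modU : mxmodule rP U.
    apply/mxmoduleP=> t Pt; apply/row_subP=> k; rewrite row_mul.
    have /sub_kermxP/translates_mxP kU := row_sub k U.
    apply/sub_kermxP/translates_mxP => s Gs.
    (* Translate [s] evaluated at [w *m perm_mx t] is translate [s * t^-1] evaluated at [w]; hence
       the kernel is stable under [P]. *)
    have Gst : (s * t^-1)%g \in G by rewrite groupM ?groupV // (subsetP sPG).
    rewrite -[RHS](kU _ Gst).
    apply: eq_bigr => i _; congr (_ * _).
    by rewrite -[t]invgK /= -col_permE mxE permM invgK.
  have : rfix_mx (submod_repr modU) P != 0.
    apply: (@rfix_pgroup_pchar _ p); rewrite ?pchar_Fp //.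
    by rewrite lt0n mxrank_eq0.
  rewrite -mxrank_eq0 rfix_submod // mxrank_in_submod ?capmxSl //.
  rewrite mxrank_eq0 => /rowV0Pn[v].
  rewrite sub_capmx => /andP[/sub_kermxP/translates_mxP vU /rfix_mxP vfix].
  case/negP; apply/eqP/rowP=> i; rewrite mxE.
  apply: (fixed0 (fun j => v 0 j)) => // s Ps j.
  by rewrite -{2}(vfix s^-1%g) ?groupV //= -col_permE mxE.
have fullNp : row_full (map_mx intr N : 'M['F_p]_(n, #|G|))^T.
  by rewrite /row_full mxrank_tr.
(* [f] selects [n] translates that are independent mod p; [M] is their integral matrix. *)
set f := fullrankfun fullNp; pose M := rowsub f N^T.
have detM : \det M != 0.
  apply: contraTneq (fullrowsub_unit fullNp) => detM0.
  suff -> : rowsub f (map_mx intr N)^T = map_mx intr M :> 'M['F_p]_n.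
    by rewrite unitmxE det_map_mx detM0 rmorph0 unitr0.
  by apply/matrixP=> i j; rewrite !mxE.
have unitM : map_mx intr M^T \in (unitmx : {pred 'M[F]_n}).
  by rewrite unitmxE det_map_mx det_tr unitfE intr_eq0.
have /translates_mxP relN : {in G, forall s : 'S_n,
    \sum_i (r i)%:~R * (\row_i a i) 0 (s i) = 0}.
  by move=> s Gs; rewrite -[RHS](relG s Gs); apply: eq_bigr => i _; rewrite mxE.
have relM : (\row_i a i) *m map_mx intr M^T = 0.
  apply/rowP=> k; have /rowP/(_ (f k)) := relN; rewrite 2!mxE => relk.
  rewrite [LHS]mxE [RHS]mxE -[RHS]relk.
  by apply: eq_bigr => j _; rewrite !mxE.
move=> i; have := congr1 (mulmxr (invmx (map_mx intr M^T))) relM.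
by rewrite /= mulmxK // mul0mx => /rowP/(_ i); rewrite !mxE.
Qed.

(** * Orbits of a Sylow subgroup *)

(** Compare the p-part of the orbit-stabilizer formula for [G] with the formula for [P]: the
    stabilizer in [P] is a p-subgroup of the stabilizer in [G], so its order divides the p-part
    there. *)
Lemma part_orbit_Sylow (aT : finGroupType) (rT : finType)
    (to : {action aT &-> rT}%g) p (G P : {group aT}) x :
  (p.-Sylow(G) P)%g -> (#|orbit to G x|`_p %| #|orbit to P x|)%N.
Proof.
move=> sylP; have [sPG pP _] := and3P sylP.
have Dp : (#|orbit to G x|`_p * #|'C_G[x | to]%g|`_p)%N
          = (#|orbit to P x| * #|'C_P[x | to]%g|)%N.
  rewrite card_orbit_stab (card_Hall sylP) -(card_orbit_stab to G x) partnM //.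
  by rewrite card_orbit.
have dvd_stab : (#|'C_P[x | to]%g| %| #|'C_G[x | to]%g|`_p)%N.
  rewrite -(@part_pnat_id p #|'C_P[x | to]%g|).
    by rewrite partn_dvd // cardSg // setSI.
  by apply: pnat_dvd pP; rewrite cardSg // subsetIl.
rewrite -(dvdn_pmul2r (cardG_gt0 'C_P[x | to])) -Dp.
by rewrite dvdn_mul.
Qed.

(** * Three-term relations and sums of signs *)

Lemma Fp_intr_eq0 p (z : int) : prime p ->
  (z%:~R == 0 :> 'F_p) = (p %| `|z|)%N.
Proof. by move=> p_pr; rewrite -(dvdz_pcharf (pchar_Fp p_pr)). Qed.

(** Adding indicators lets the three indices coincide, as the three roots may. *)
Definition three_term n (i1 i2 i3 : 'I_n) (e : int) (i : 'I_n) : int :=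
  (i == i1)%:R + (i == i2)%:R + e * (i == i3)%:R.

Lemma sum_three_term (R : comNzRingType) n (i1 i2 i3 : 'I_n) e (v : 'I_n -> R) :
  \sum_i (three_term i1 i2 i3 e i)%:~R * v i = v i1 + v i2 + e%:~R * v i3.
Proof.
have sum_delta (j : 'I_n) : \sum_i (i == j)%:R * v i = v j.
  rewrite (bigD1 j) //= eqxx mul1r big1 ?addr0 // => i /negPf->.
  by rewrite mul0r.
rewrite -(sum_delta i1) -(sum_delta i2) -(sum_delta i3) mulr_sumr -!big_split.
apply: eq_bigr => i _ /=.
by rewrite /three_term !rmorphD rmorphM /= !rmorph_nat !mulrDl mulrA.
Qed.

(** By transitivity the sum is the same for every [i]; summed over all [i] first, each [s]
    contributes [#|A| - #|~: A| = 0]. *)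
Lemma sum_transitive_sign n (G : {group 'S_n}) (A : {set 'I_n}) i :
    [transitive G, on setT | 'P]%g -> #|A| = #|~: A| ->
  \sum_(s in G) (-1) ^+ ((s : 'S_n) i \notin A) = 0 :> int.
Proof.
move=> trG cardA.
pose c j : int := \sum_(s in G) (-1) ^+ ((s : 'S_n) j \notin A).
have cE j : c j = c i.
  have [t Gt ->] := atransP2 trG (in_setT i) (in_setT j).
  rewrite /c [RHS](reindex_inj (mulgI t)); apply: eq_big => [s | s _] /=.
    by rewrite groupMl.
  by rewrite permM.
have : \sum_j c j = 0.
  rewrite exchange_big big1 //= => s _.
  rewrite -(reindex_inj (@perm_inj _ s) (P := predT)
             (F := fun j => (-1) ^+ (j \notin A) : int)) /=.
  rewrite (bigID [in A]) /= (eq_bigr (fun=> 1)) => [|j]; last by move=> ->.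
  rewrite [X in _ + X](eq_bigr (fun=> -1)) => [|j]; last by move=> ->.
  rewrite !sumr_const mulNrn cardA.
  by rewrite (eq_card (B := ~: A)) ?subrr // => j; rewrite !inE.
rewrite (eq_bigr (fun=> c i)) // sumr_const card_ord => /eqP.
rewrite mulrn_eq0 => /orP[/eqP n0 | /eqP //].
by have : (i < 0)%N by rewrite -n0.
Qed.

(** * Solutions mod p fixed by a Sylow p-subgroup *)

Section ThreeTerm.

Variables (n p m : nat) (G P : {group 'S_n}) (i1 i2 i3 : 'I_n) (e : int).
Hypotheses (p_pr : prime p) (e1 : `|e| = 1).
Hypotheses (trG : [transitive G, on setT | 'P]%g) (sylP : (p.-Sylow(G) P)%g).
Variable v : 'I_n -> 'F_p.
Hypothesis v_fixed : {in P, forall (s : 'S_n) i, v (s i) = v i}.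
Hypothesis v_relation :
  {in G, forall s : 'S_n, v (s i1) + v (s i2) + e%:~R * v (s i3) = 0}.

Let v_orbit i j : j \in orbit 'P%act P i -> v j = v i.
Proof. by case/imsetP=> s Ps ->; apply: v_fixed. Qed.

Let dvdn_part_orbit i : (n`_p %| #|orbit 'P%act P i|)%N.
Proof.
have := part_orbit_Sylow 'P i sylP.
by rewrite (atransP trG) ?inE // cardsT card_ord.
Qed.

Lemma fixed_relation_eq0_prime_power :
  n = (p ^ m)%N -> p <> 3%N -> forall i, v i = 0.
Proof.
move=> Dn p_neq3.
have v_const i : v i = v i1.
  apply: v_orbit; suff -> : orbit 'P%act P i1 = setT by [].
  apply/eqP; rewrite eqEcard subsetT cardsT card_ord.
  have := dvdn_part_orbit i1.
  rewrite part_pnat_id; last by rewrite Dn pnatX pnat_id.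
  by apply: dvdn_leq; apply/card_gt0P; exists i1; apply: orbit_refl.
have := v_relation (group1 G); rewrite !perm1 !v_const.
have -> : v i1 + v i1 + e%:~R * v i1 = (2 + e)%:~R * v i1.
  by rewrite rmorphD /= mulrDl; ring.
move=> /eqP; rewrite mulf_eq0 Fp_intr_eq0 // => /orP[|/eqP v0 i]; last first.
  by rewrite v_const.
have [->|->] : e = 1 \/ e = -1 by lia.
  by rewrite /= dvdn_prime2 // => /eqP.
by rewrite /= dvdn1 gtn_eqF ?prime_gt1.
Qed.

Lemma fixed_relation_eq0_twice_prime_power :
  n = (2 * p ^ m)%N -> (5 <= p)%N -> forall i, v i = 0.
Proof.
move=> Dn p_ge5.
have part_n : (n`_p)%N = (p ^ m)%N.
  rewrite Dn partnM ?expn_gt0 ?prime_gt0 // part_p'nat ?mul1n.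
    by rewrite part_pnat_id // pnatX pnat_id.
  by rewrite p'natE // gtnNdvd // (leq_trans _ p_ge5).
set A := orbit 'P%act P i1.
have pm_gt0 : (0 < p ^ m)%N by rewrite expn_gt0 prime_gt0.
have orb_ge i : (p ^ m <= #|orbit 'P%act P i|)%N.
  rewrite -part_n dvdn_leq //.
  by apply/card_gt0P; exists i; apply: orbit_refl.
have cardC : (#|A| + #|~: A|)%N = n by rewrite cardsC card_ord.
have cardA : #|A| = (p ^ m)%N.
  (* The orbit size is a power of p, at least [p ^ m]; the next power already exceeds
     [n = 2 * p ^ m]. *)
  have [k Dk] := p_natP (pnat_dvd (dvdn_orbit 'P%act P i1) (pHall_pgroup sylP)).
  have := orb_ge i1; rewrite -/A in Dk *; rewrite Dk leq_exp2l ?prime_gt1 //.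
  rewrite leq_eqVlt => /orP[/eqP-> // | lt_mk].
  have : (p ^ m.+1 <= p ^ k)%N by rewrite leq_exp2l ?prime_gt1.
  by rewrite -Dk expnS; nia.
have cardCA : #|~: A| = (p ^ m)%N by lia.
have [y nAy] : exists y, y \in ~: A by apply/card_gt0P; rewrite cardCA.
have orb_y : orbit 'P%act P y = ~: A.
  apply/eqP; rewrite eqEcard cardCA orb_ge andbT; apply/subsetP=> z yz.
  rewrite inE; apply: contraL nAy => Az; rewrite inE negbK /A.
  by rewrite -(orbit_eqP Az) orbit_sym.
have vA i : i \in A -> v i = v i1 by apply: v_orbit.
have vC i : i \notin A -> v i = v y.
  by move=> nAi; apply: v_orbit; rewrite orb_y inE.
pose x i : int := (-1) ^+ (i \notin A).
have v2 i : 2 * v i = (v i1 + v y) + (x i)%:~R * (v i1 - v y).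
  by rewrite /x; case: (boolP (i \in A)) => [/vA|/vC] ->;
     rewrite /= rmorphXn ?expr0 ?expr1 //=; ring.
pose k (s : 'S_n) : int := x (s i1) + x (s i2) + e * x (s i3).
have rel2 (s : 'S_n) : s \in G ->
    (2 + e)%:~R * (v i1 + v y) + (k s)%:~R * (v i1 - v y) = 0.
  move=> Gs; rewrite -[RHS](mulr0 2) -(v_relation Gs) !mulrDr mulrCA !v2.
  by rewrite /k !rmorphD !rmorphM /=; ring.
have k_sum : \sum_(s in G) k s = 0.
  rewrite /k !big_split -mulr_sumr /=.
  by rewrite !sum_transitive_sign // ?mulr0 // cardA cardCA.
(* If [k] were constant, its zero sum would force the value 0, but a sum of three signs is odd. *)
have [s Gs k_neq] : exists2 s, s \in G & k s != k 1%g.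
  apply/exists_inP; apply: contraT; rewrite negb_exists_in.
  move=> /forall_inP k_const.
  move: k_sum; rewrite (eq_bigr (fun=> k 1%g)) => [|s /k_const].
    rewrite sumr_const => /eqP; rewrite mulrn_eq0 eqn0Ngt cardG_gt0 /= /k /x.
    have [->|->] : e = 1 \/ e = -1 by lia.
      by do 3!case: (_ \notin A).
    by do 3!case: (_ \notin A).
  by rewrite negbK => /eqP.
(* The bound 12 covers both uses: a nonzero [k s - k 1] is 2, 4 or 6 up to sign, and [2 * (2 + e)]
   is 2 or 6. *)
have nz_Fp z : (`|z| %| 12)%N -> z%:~R != 0 :> 'F_p.
  move=> z_dvd; rewrite Fp_intr_eq0 //; apply/negP=> /dvdn_trans/(_ z_dvd).
  rewrite (_ : 12 = 4 * 3)%N // Euclid_dvdM // => /orP[] /dvdn_leq; lia.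
have v_y : v i1 = v y.
  apply/eqP; rewrite -subr_eq0.
  have : (k s - k 1%g)%:~R * (v i1 - v y) = 0.
    rewrite rmorphB mulrBl -[RHS](subrr 0) -{1}(rel2 s) // -(rel2 1%g) //.
    by ring.
  move/eqP; rewrite mulf_eq0 => /orP[|//]; rewrite (negPf (nz_Fp _ _)) //.
  move: k_neq; rewrite /k /x; have [->|->] : e = 1 \/ e = -1 by lia.
    by do 6!case: (_ \notin A).
  by do 6!case: (_ \notin A).
have vy0 : v y = 0.
  have := rel2 1%g (group1 G); rewrite v_y subrr mulr0 addr0.
  have -> : (2 + e)%:~R * (v y + v y) = (2 * (2 + e))%:~R * v y.
    by rewrite !rmorphM /=; ring.
  move/eqP; rewrite mulf_eq0 (negPf (nz_Fp _ _)) => [/eqP //|].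
  by have [->|->] : e = 1 \/ e = -1 by lia.
by move=> i; case: (boolP (i \in A)) => [/vA|/vC] ->; rewrite ?v_y.
Qed.

End ThreeTerm.

(** * The Galois group as a permutation group of the roots *)

(** A nonconstant gcd with the derivative would be associate to [f], which cannot divide a nonzero
    polynomial of smaller degree. *)
Lemma irreducible_separable (F : numFieldType) (f : {poly F}) :
  irreducible_poly f -> separable_poly f.
Proof.
case=> f_gt1 f_irr; rewrite unlock /coprimep; apply: contraTT isT => nz_gcd.
have /eqp_dvdl Ef := f_irr _ nz_gcd (dvdp_gcdl _ _).
have : f %| f^`() by rewrite -Ef dvdp_gcdr.
have df_nz : f^`() != 0.
  have sz : (size f).-2.+1 = (size f).-1 by rewrite prednK // -subn1 subn_gt0.
  apply/eqP=> /(congr1 (fun q : {poly F} => q`_(size f).-2)).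
  rewrite coef0 coef_deriv sz => /eqP; rewrite mulrn_eq0 -lead_coefE.
  by rewrite lead_coef_eq0 -size_poly_eq0 -(subnKC f_gt1).
move/(dvdp_leq df_nz); rewrite leqNgt lt_size_deriv //.
by rewrite -size_poly_gt0 ltnW.
Qed.

Lemma irreducible_root_perm_group (f : {poly rat}) (d : nat) :
    size f = d.+1 -> irreducible_poly f ->
  exists (a : 'I_d -> algC) (G : {group 'S_d}),
    [/\ injective a,
        forall x, root (map_poly ratr f) x -> exists i, x = a i,
        [transitive G, on setT | 'P]%g &
        {in G, forall s : 'S_d,
           exists u : {rmorphism algC -> algC}, forall i, u (a i) = a (s i)}].
Proof.
move=> szf f_irr; have [f_gt1 _] := f_irr.
have nzf : f != 0 by rewrite -size_poly_gt0 ltnW.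
have [rs Drs] := closed_field_poly_normal (map_poly ratr f : {poly algC}).
(* [L] is the splitting field of [f], generated by the roots [r], and [LC] embeds it in [algC]. *)
have [L [LC [r DrC genL]]] := num_field_exists rs.
have fLC : map_poly LC (map_poly (in_alg L) f) = map_poly ratr f.
  rewrite -map_poly_comp; apply: eq_map_poly => c /=.
  by rewrite rmorphZ_num rmorph1 mulr1.
set fL := map_poly (in_alg L) f in fLC.
have DfL : fL %= \prod_(z <- r) ('X - z%:P).
  rewrite -(eqp_map LC) fLC Drs.
  have -> : map_poly LC (\prod_(z <- r) ('X - z%:P)) =
            \prod_(z <- rs) ('X - z%:P).
    rewrite rmorph_prod -DrC big_map; apply: eq_bigr => z _.
    by rewrite /= map_polyXsubC.
  by rewrite eqp_scale ?lead_coef_eq0 ?map_poly_eq0.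
have fLK : fL \is a polyOver 1%AS.
  by apply/polyOverP=> i; rewrite coef_map /= rpredZ ?rpred1.
have sepfL : separable_poly fL.
  by rewrite separable_map irreducible_separable.
have splitL : splittingFieldFor 1 fL {:L} by exists r.
have L_ax : FieldExt_isSplittingField _ L by constructor; exists fL.
pose K : splittingFieldType rat := HB.pack_for (splittingFieldType rat) L L_ax.
have galK : galois 1 {:K} by apply/splitting_galoisField; exists fL.
have Ur : uniq r.
  by rewrite -separable_prod_XsubC -(eqp_separable DfL).
have szr : size r = d.
  apply: succn_inj; rewrite -(size_prod_XsubC _ id) -(eqp_size DfL).
  by rewrite size_map_poly.
pose b (i : 'I_d) : K := r`_i.
have b_inj : injective b.
  by move=> i j /eqP; rewrite nth_uniq ?szr // => /eqP/val_inj.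
have rootb x : root fL x -> exists i, x = b i.
  rewrite (eqp_root DfL) root_prod_XsubC => rx.
  have lt_x : (index x r < d)%N by rewrite -szr index_mem.
  by exists (Ordinal lt_x); rewrite /b nth_index.
have broot i : root fL (b i).
  by rewrite (eqp_root DfL) root_prod_XsubC mem_nth ?szr.
have gal_root (g : gal_of {:K}) x : root fL x -> root fL (g x).
  suff {2}-> : fL = map_poly g fL by rewrite fmorph_root.
  rewrite -map_poly_comp; apply: eq_map_poly => c /=.
  by rewrite linearZ /= rmorph1.
have galP (g : gal_of {:K}) : exists s : 'S_d, forall i, g (b i) = b (s i).
  have /fin_all_exists[h Dh] i : exists j, g (b i) = b j.
    exact/rootb/gal_root.
  have h_inj : injective h.
    move=> i j hij; apply/b_inj/(fmorph_inj g).
    by apply: etrans (Dh i) _; rewrite hij; apply/esym/Dh.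
  by exists (perm h_inj) => i; rewrite permE.
pose G := [set s : 'S_d |
  [exists g : gal_of {:K}, [forall i, g (b i) == b (s i)]]].
have GP (s : 'S_d) :
    s \in G -> exists g : gal_of {:K}, forall i, g (b i) = b (s i).
  by rewrite inE => /existsP[g /forallP gP]; exists g => i; apply/eqP.
have GI (s : 'S_d) (g : gal_of {:K}) : (forall i, g (b i) = b (s i)) -> s \in G.
  move=> gP; rewrite inE; apply/existsP; exists g.
  by apply/forallP=> i; apply/eqP.
have groupG : group_set G.
  apply/group_setP; split.
    by apply: (GI _ 1%g) => i; rewrite gal_id perm1.
  move=> s t /GP[g gP] /GP[h hP]; apply: (GI _ (g * h)%g) => i.
  by rewrite galM ?memvf // gP hP permM.
exists (LC \o b), (Group groupG); split.
- by apply: inj_comp => //; apply: fmorph_inj.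
- move=> x; rewrite Drs rootZ ?lead_coef_eq0 ?map_poly_eq0 // root_prod_XsubC.
  rewrite -DrC => /mapP[y ry ->]; have [|i ->] := rootb y; last by exists i.
  by rewrite (eqp_root DfL) root_prod_XsubC.
- have d_gt0 : (0 < d)%N by rewrite -ltnS -szf.
  apply/imsetP; exists (Ordinal d_gt0); rewrite ?inE //.
  apply/esym/setP=> j; rewrite inE; apply/orbitP.
  (* Transitivity: by irreducibility [f] is associate to the minimal polynomial of one root, so the
     Galois group moves that root to any other. *)
  have : root (minPoly 1 (b (Ordinal d_gt0))) (b j).
    have /polyOver1P[q Dq] := minPolyOver 1 (b (Ordinal d_gt0)).
    have /= dvd_qf := minPoly_dvdp fLK (broot (Ordinal d_gt0)).
    have q_f : q %= f.
      case: f_irr => _; apply; last by rewrite -(dvdp_map (in_alg L)) -Dq.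
      by rewrite -(size_map_poly (in_alg L)) -Dq size_minPoly.
    by rewrite Dq (eqp_root (etrans (eqp_map _ _ _) q_f)) broot.
  have [_ _ nK] := and3P galK.
  move/(normalField_root_minPoly (sub1v _) nK (memvf _)) => [g _ gb].
  have [s sP] := galP g.
  exists s; first exact: GI sP.
  by apply: b_inj; rewrite -gb sP.
move=> s /GP[g gP]; have [u uP] := extend_algC_subfield_aut LC g.
by exists u => i; apply: etrans (esym (uP _)) (congr1 LC (gP i)).
Qed.

(** * Nonvanishing for both signs *)

Lemma three_roots_relation_neq0 (f : {poly rat}) (d : nat) (e : int)
    (a1 a2 a3 : algC) :
    size f = d.+1 -> irreducible_poly f ->
    (exists p m : nat,
       [/\ prime p, p <> 3%N, (1 <= m)%N & d = (p ^ m)%N]) \/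
    (exists p m : nat,
       [/\ prime p, (5 <= p)%N, (1 <= m)%N & d = (2 * p ^ m)%N]) ->
    root (map_poly ratr f) a1 -> root (map_poly ratr f) a2 ->
    root (map_poly ratr f) a3 -> `|e| = 1 ->
  a1 + a2 + e%:~R * a3 <> 0.
Proof.
move=> szf f_irr d_form; have [a [G [a_inj rootP trG autG]]] :=
  irreducible_root_perm_group szf f_irr.
move=> /rootP[i1 ->] /rootP[i2 ->] /rootP[i3 ->] e1 rel.
have d_gt1 : (1 < d)%N.
  by case: d_form => [[p [[|m]]]|[p [m]]] [p_pr _ _ ->] //;
     have := prime_gt1 p_pr; have := expn_gt0 p m; rewrite ?expnS; nia.
(* As [d > 1], there are two distinct roots, which cannot both be 0. *)
suff a0 : forall i, a i = 0.
  have := a_inj (Ordinal d_gt1) (Ordinal (ltnW d_gt1)).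
  by rewrite !a0 => /(_ erefl)/(congr1 val).
(* Automorphisms of [algC] fix the integer coefficients, so they carry the relation to all its
   translates. *)
have relG : {in G, forall s : 'S_d,
    \sum_i (three_term i1 i2 i3 e i)%:~R * a (s i) = 0}.
  move=> s /autG[u uP]; rewrite (sum_three_term i1 i2 i3 e (a \o s)) /= -!uP.
  by rewrite -(rmorph_int u) -rmorphM -!rmorphD rel rmorph0.
have [p p_pr fixed0] : exists2 p, prime p &
    forall (P : {group 'S_d}) (v : 'I_d -> 'F_p),
    (p.-Sylow(G) P)%g ->
    {in P, forall (s : 'S_d) i, v (s i) = v i} ->
    {in G, forall s : 'S_d, v (s i1) + v (s i2) + e%:~R * v (s i3) = 0} ->
  forall i, v i = 0.
  case: d_form => [] [p [m [p_pr p_ok _ Dd]]];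
    exists p => // P v sylP v_fix v_rel.
    exact: (fixed_relation_eq0_prime_power _ _ trG sylP v_fix v_rel Dd).
  exact: (fixed_relation_eq0_twice_prime_power _ _ trG sylP v_fix v_rel Dd).
have [P sylP] := Sylow_exists p G; have [sPG pP _] := and3P sylP.
apply: relation_translates_eq0 p_pr sPG pP _ relG => v v_fix v_rel.
apply: (fixed0 P) => // s Gs; rewrite -[RHS](v_rel s Gs).
by rewrite (sum_three_term i1 i2 i3 e (v \o s)).
Qed.

Theorem theorem2 (f : {poly rat}) (d : nat)
    (f_deg : size f = d.+1)
    (f_irr : irreducible_poly f)
    (d_form :
      (exists p m : nat,
         [/\ prime p, p <> 3%N, (1 <= m)%N & d = (p ^ m)%N]) \/
      (exists p m : nat,
         [/\ prime p, (5 <= p)%N, (1 <= m)%N & d = (2 * p ^ m)%N]))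
    (a1 a2 a3 : algC)
    (a1_root : root (map_poly ratr f) a1)
    (a2_root : root (map_poly ratr f) a2)
    (a3_root : root (map_poly ratr f) a3) :
  a1 + a2 + a3 <> 0 /\ a1 + a2 - a3 <> 0.
Proof.
split.
  by rewrite -[a3]mul1r; apply: (three_roots_relation_neq0 (e := 1) f_deg).
by rewrite -mulN1r; apply: (three_roots_relation_neq0 (e := -1) f_deg).
Qed.
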